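(* Let $m,n\in\mathbf{N}_0$, let $\mu$ be a partition of $m$, $\nu$ a partition of $n$ and $\lambda$ a partition of $mn$. If $r\in\mathbf{N}_0$ is at least the greatest part of $\mu$ then \[ \langle s_\nu\circ s_{(r)\sqcup\mu},\, s_{(nr)\sqcup\lambda}\rangle=\langle s_\nu\circ s_\mu,\, s_\lambda\rangle. \]
   Context: $s_\lambda$ is the Schur function labelled by the partition $\lambda$; $\circ$ is the plethysm product of symmetric functions ($f\circ s_\mu$ is obtained from the symmetric function $f(x_1,x_2,\ldots)$ by substituting for its variables the monomials $x^t$, where $t$ ranges over all semistandard $\mu$-tableaux with positive integer entries and $x^t=\prod_b x_b^{\#\text{ entries of }t\text{ equal to }b}$). $\langle\cdot,\cdot\rangle$ is the Hall inner product, for which Schur functions are orthonormal. For partitions $\alpha,\beta$, $\alpha\sqcup\beta$ is the partition whose multiset of parts is the disjoint union of the multisets of parts of $\alpha$ and $\beta$. *)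

(* Defs.v *)
From HB Require Import structures.
From mathcomp Require Import all_boot all_order all_algebra.
From mathcomp Require Import finmap mpoly.
From mathcomp Require Import classical_sets.

Set Implicit Arguments.
Unset Strict Implicit.
Unset Printing Implicit Defensive.

Import GRing.Theory.
Local Open Scope ring_scope.

Record intpart := IntPart {
  parts :> seq nat;
  partsP : sorted geq parts && (0%N \notin parts) }.

HB.instance Definition _ := [isSub for parts].
HB.instance Definition _ := [Equality of intpart by <:].
HB.instance Definition _ := [Choice of intpart by <:].

Lemma row_part_subproof r :
  sorted geq (nseq (0 < r)%N r) && (0%N \notin nseq (0 < r)%N r).
Proof. by case: r. Qed.

(* The one-row partition (r); it has no parts when r = 0. *)
Definition row_part r : intpart := IntPart (row_part_subproof r).

Lemma sqcup_subproof (al be : intpart) :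
  sorted geq (sort geq (al ++ be)) && (0%N \notin sort geq (al ++ be)).
Proof.
have geq_total : total geq by move=> x y; apply: leq_total.
rewrite (sort_sorted geq_total) mem_sort mem_cat negb_or.
by case/andP: (partsP al) => _ ->; case/andP: (partsP be) => _ ->.
Qed.

Definition sqcup (al be : intpart) : intpart :=
  IntPart (sqcup_subproof al be).

(* A box of the Young diagram of la is a row index i together with a column   *)
(* index j < la_i.                                                            *)
Definition box (la : intpart) :=
  {i : 'I_(size la) & 'I_(nth 0%N la i)}.

Definition brow (la : intpart) (b : box la) : nat := tag b.
Definition bcol (la : intpart) (b : box la) : nat := tagged b.

(* Semistandard la-tableaux with entries in {1, ..., N}, relabelled as        *)
(* {0, ..., N - 1} to match the indexing of the variables of {mpoly int[N]}.  *)
Definition ssyt (la : intpart) (N : nat) : {set {ffun box la -> 'I_N}} :=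
  [set t : {ffun box la -> 'I_N} | [forall b, forall c,
    ((brow b == brow c) && (bcol b < bcol c) ==> (t b <= t c))%N &&
    ((bcol b == bcol c) && (brow b < brow c) ==> (t b < t c))%N]].

Definition content (la : intpart) (N : nat) (t : {ffun box la -> 'I_N}) :
  'X_{1..N} := [multinom #|[set b | t b == i]| | i < N].

(* A symmetric function f(x_1, x_2, ...) is given by the compatible family of *)
(* its restrictions f(x_1, ..., x_N, 0, 0, ...), N >= 0, i.e. as an element   *)
(* of the inverse limit of the rings of symmetric polynomials.                *)
Definition symfun := forall N : nat, {mpoly int[N]}.

Definition schur (la : intpart) : symfun :=
  fun N => \sum_(t in ssyt la N) 'X_[content t].

(* f \o s_mu: setting x_i = 0 for i > N kills the monomials x^t of the        *)
(* tableaux t having an entry > N, so that only those with entries <= N are   *)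
(* left to be substituted in f. As f is symmetric, their order is irrelevant. *)
Definition plethysm (f : symfun) (mu : intpart) : symfun :=
  fun N => f #|ssyt mu N| \mPo
             [tuple 'X_[content (enum_val i)] | i < #|ssyt mu N|].

Definition is_schur_expansion (f : symfun)
    (c : {fsfun intpart -> int with 0}) : Prop :=
  forall N : nat, f N = \sum_(la <- finsupp c) c la *: schur la N.

(* The coordinates of f in the Z-basis of Schur functions of the ring of      *)
(* symmetric functions; meaningless if f is not a symmetric function.         *)
Definition schur_coord (f : symfun) : {fsfun intpart -> int with 0} :=
  xget [fsfun] (is_schur_expansion f).

(* The Hall inner product: the bilinear form for which the Schur functions    *)
(* are orthonormal.                                                           *)
Definition hall (f g : symfun) : int :=
  \sum_(la <- finsupp (schur_coord f)) schur_coord f la * schur_coord g la.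

(* Main.v *)
From HB Require Import structures.
Require Import Defs.
From mathcomp Require Import all_boot all_order all_algebra.
From mathcomp Require Import all_fingroup zify.
From mathcomp Require Import finmap mpoly.
From mathcomp Require classical_sets.

(** Write mu+ for the partition (r) \sqcup mu, and follow the powers of one
    variable x.  A semistandard tableau of shape kappa has no repeated entry in
    a column, so it contains a given letter at most kappa_1 times; if x is the
    variable of the smallest letter, the tableaux with x-degree kappa_1 are
    those whose first row is filled with it, and what remains of them is an
    arbitrary tableau of shape kappa minus its first row in the other letters.
    Hence the part of s_kappa of highest degree in x is x ^ kappa_1 times the
    Schur function of kappa minus its first row.  Applied to the mu+-tableaux
    that are substituted in s_nu, this shows that s_nu o s_mu+ has degree at
    most n r in x, and that the coefficient of x ^ (n r) is s_nu o s_mu in the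
    other variables, because the weights of lower x-degree contribute nothing
    to it (has_top_plethysm).  In the recursion used below x is the variable of
    the largest letter, which then fills the bottom boxes of all columns.

    Now let s_nu o s_mu+ be the sum of the c_kappa s_kappa.  No kappa in it has
    a first part greater than n r, and comparing the coefficients of x ^ (n r)
    gives s_nu o s_mu as the sum, over the kappa with first part n r, of
    c_kappa times the Schur function of kappa minus its first row.  These are
    pairwise distinct Schur functions, so by linear independence the
    coefficient of s_lambda in s_nu o s_mu is c_((n r) \sqcup lambda).  If
    lambda_1 > n r both coefficients vanish.

    The argument needs that Schur functions are symmetric, linearly independent
    and span the symmetric functions.  All three follow from the fact that
    deleting the largest letter of a tableau deletes a horizontal strip
    (perm_sst_tab_weights).  Symmetry is then the Bender-Knuth involution,
    which in terms of chains of shapes reverses intervals of integers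
    (strips_swap).  Independence (schur_comb_eq0) and spanning (schur_comb_ex)
    are obtained by the same comparison of highest powers of one variable, by
    induction on the degree.  A symmetric function is handled there through the
    function giving its coefficients, whose arguments are lists of exponents
    of any length. *)

Set Implicit Arguments.
Unset Strict Implicit.
Unset Printing Implicit Defensive.

Import GRing.Theory.

(** * Horizontal strips *)

(** Reduces invariance under permutations to adjacent swaps, which is what
    the Bender-Knuth involution provides. *)
Lemma perm_eq_ind_swap (T : eqType) (R : seq T -> seq T -> Prop) :
  (forall s, R s s) ->
  (forall s1 s2 s3, R s1 s2 -> R s2 s3 -> R s1 s3) ->
  (forall x s1 s2, R s1 s2 -> R (x :: s1) (x :: s2)) ->
  (forall x y s, R (x :: y :: s) (y :: x :: s)) ->
  forall s1 s2, perm_eq s1 s2 -> R s1 s2.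
Proof.
move=> Rrefl Rtrans Rcons Rswap.
have Rmove x s t : R (x :: s ++ t) (s ++ x :: t).
  elim: s => [|y s IH]; first exact: Rrefl.
  apply: Rtrans (Rswap _ _ _) _; exact: Rcons.
elim=> [|x s1 IH] s2.
  by rewrite perm_sym => /perm_nilP ->; apply: Rrefl.
move=> ps; have xs2: x \in s2 by rewrite -(perm_mem ps) mem_head.
case/splitPr: xs2 ps => p1 p2 ps.
apply: Rtrans (Rmove x p1 p2); apply/Rcons/IH.
by move: ps; rewrite -cat1s perm_sym -[x :: p2]cat1s perm_catCA perm_cat2l
  perm_sym.
Qed.

(** The shapes obtained from l by removing a horizontal strip. They are kept
    as lists of the same length as l, with trailing zeros if necessary, so
    that the interlacing condition can be read off index by index. *)
Fixpoint strips (l : seq nat) : seq (seq nat) :=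
  if l is a :: l' then
    [seq b :: t | b <- index_iota (head 0 l') a.+1, t <- strips l']
  else [:: [::]].

Lemma stripsP (l t : seq nat) :
  reflect (size t = size l /\
           forall i, nth 0 l i.+1 <= nth 0 t i <= nth 0 l i)
          (t \in strips l).
Proof.
elim: l t => [|a l IH] t /=.
  rewrite inE; apply: (iffP eqP) => [->|[]]; last by move/size0nil.
  by split=> // i; rewrite !nth_nil.
apply: (iffP allpairsP) => [[[b t'] /= [hb ht ->]]|[]].
  have [sz ht'] := IH _ ht; split; first by rewrite /= sz.
  case=> [|i] /=; last exact: ht'.
  by move: hb; rewrite mem_index_iota ltnS nth0.
case: t => // b t [sz] h; exists (b, t); split=> //=.
  by have := h 0; rewrite /= nth0 mem_index_iota ltnS.
by apply/IH; split=> // i; apply: (h i.+1).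
Qed.

Lemma strips_uniq l : uniq (strips l).
Proof.
elim: l => //= a l IH; apply: allpairs_uniq => //; first exact: iota_uniq.
by move=> [b t] [b' t'] _ _ /= [-> ->].
Qed.

Lemma sorted_geqP l :
  reflect (forall i, nth 0 l i.+1 <= nth 0 l i) (sorted geq l).
Proof.
elim: l => [|a l IH] /=; first by apply: ReflectT => i; rewrite nth_nil.
case: l IH => [|b l] IH /=; first by apply: ReflectT => -[|[|i]].
apply: (iffP andP) => [[ab /IH h] [|i] //=|h]; first exact: (h i).
by split; [apply: (h 0) | apply/IH => i; apply: (h i.+1)].
Qed.

Lemma nth_sorted_geq l i j : sorted geq l -> i <= j -> nth 0 l j <= nth 0 l i.
Proof.
move/sorted_geqP=> h /subnKC <-; elim: (j - i) => [|d IH];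
  first by rewrite addn0.
by rewrite addnS (leq_trans (h _)).
Qed.

Lemma strips_sorted l t : t \in strips l -> sorted geq t.
Proof.
case/stripsP=> _ h; apply/sorted_geqP=> i.
by have := h i; have := h i.+1; lia.
Qed.

Lemma strips_refl l : sorted geq l -> l \in strips l.
Proof. by move/sorted_geqP=> h; apply/stripsP; split=> // i;
  rewrite h leqnn. Qed.

Lemma sumn_nth l k : size l <= k -> sumn l = \sum_(i < k) nth 0 l i.
Proof.
move=> le_k; rewrite sumnE (big_nth 0) big_mkord (big_ord_widen _ _ le_k).
rewrite [RHS](bigID (fun i : 'I_k => i < size l)) /= [X in _ + X]big1 ?addn0 //.
by move=> i; rewrite -leqNgt => /(nth_default 0).
Qed.

Lemma strips_sumn l t : t \in strips l -> sumn t <= sumn l.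
Proof.
case/stripsP=> sz h; rewrite (@sumn_nth t (size l)) ?sz // (@sumn_nth l (size
  l)) //.
by apply: leq_sum => i _; case/andP: (h i).
Qed.

Lemma strips_sumn_eq l t : t \in strips l -> sumn t = sumn l -> t = l.
Proof.
elim: l t => [|a l IH] t /=; first by rewrite inE => /eqP.
case/allpairsP=> [[b t'] /= [hb ht ->]] /=.
move: hb; rewrite mem_index_iota ltnS => hb.
have := strips_sumn ht => le e; have: b = a /\ sumn t' = sumn l by lia.
by case=> -> /(IH _ ht) ->.
Qed.

Section Reflection.

Variables l u : seq nat.

Let lo i := maxn (nth 0 l i.+1) (nth 0 u i).
Let hi i := if i is j.+1 then minn (nth 0 l i) (nth 0 u j) else nth 0 l 0.

(** When l and u are given, the parts of an intermediate shape t range over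
    intervals [lo i, hi i] independently of each other. Reversing all these
    intervals is the Bender-Knuth involution for the two letters that fill l
    / t and t / u. *)
Definition reflect_strip t := mkseq (fun i => lo i + hi i - nth 0 t i) (size l).

Let betweenP t :
  reflect [/\ size t = size l, size u = size l &
              forall i, lo i <= nth 0 t i <= hi i]
          ((t \in strips l) && (u \in strips t)).
Proof.
apply: (iffP andP) => [[/stripsP[st ht] /stripsP[su hu]]|[st su h]].
  split=> //; first by rewrite su.
  case=> [|i]; first by have := ht 0; have := hu 0; rewrite /lo /hi; lia.
  by have := ht i.+1; have := hu i.+1; have := hu i; rewrite /lo /hi; lia.
split; apply/stripsP; split; rewrite ?st // => i.
  by have := h i; rewrite /lo /hi; case: i => [|i]; lia.
by have := h i; have := h i.+1; rewrite /lo /hi; lia.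
Qed.

Let nth_reflect t i : size u = size l -> nth 0 t i <= hi i ->
  size t = size l ->
  nth 0 (reflect_strip t) i = lo i + hi i - nth 0 t i.
Proof.
move=> su le_hi st; case: (ltnP i (size l)) => hil; first by rewrite nth_mkseq.
rewrite nth_default ?size_mkseq // /lo /hi.
have l0 j : size l <= j -> nth 0 l j = 0 by apply: nth_default.
have u0 j : size l <= j -> nth 0 u j = 0 by rewrite -su; apply: nth_default.
rewrite (l0 i.+1) ?(leqW hil) // (u0 i) //.
by case: i {le_hi} hil => [|i] hil; rewrite l0 ?min0n.
Qed.

Let reflect_between t : (t \in strips l) && (u \in strips t) ->
  (reflect_strip t \in strips l) && (u \in strips (reflect_strip t)).
Proof.
case/betweenP=> st su h; apply/betweenP; split=> //;
  first by rewrite size_mkseq.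
by move=> i; have := h i; rewrite nth_reflect //; [lia | case/andP: (h i)].
Qed.

Let reflectK t : (t \in strips l) && (u \in strips t) ->
  reflect_strip (reflect_strip t) = t.
Proof.
move=> ht; have /betweenP[st su h] := ht.
have /betweenP[st' _ h'] := reflect_between ht.
apply: (@eq_from_nth _ 0) => [|i _]; first by rewrite size_mkseq st.
have [/andP[_ le1] /andP[_ le2]] := (h i, h' i).
rewrite nth_reflect // nth_reflect //; have := h i; lia.
Qed.

(** The endpoints of the intervals add up to |l| + |u|, because max(l_(i+1),
    u_i) + min(l_(i+1), u_i) = l_(i+1) + u_i. *)
Lemma sumn_reflect t : (t \in strips l) && (u \in strips t) ->
  sumn t + sumn (reflect_strip t) = sumn l + sumn u.
Proof.
case/betweenP=> st su h; pose k := size l.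
rewrite (@sumn_nth _ k) ?st // (@sumn_nth (reflect_strip _) k) ?size_mkseq //.
rewrite (@sumn_nth l k.+1) // (@sumn_nth u k) ?su // -big_split /=.
rewrite (eq_bigr (fun i : 'I_k => lo i + hi i)); last first.
  move=> i _; rewrite nth_reflect //; last by case/andP: (h i).
  by have := h i; lia.
rewrite big_split /=.
have hi_k : hi k = 0.
  rewrite /hi; case e: k => [|j]; first by rewrite nth_default // -e.
  by rewrite nth_default ?min0n // -e.
have ->: \sum_(i < k) hi i = \sum_(i < k.+1) hi i.
  by rewrite big_ord_recr /= hi_k addn0.
rewrite !big_ord_recl /= addnC -!addnA; congr (_ + _).
rewrite -!big_split /=; apply: eq_bigr => i _.
by rewrite /lo /bump /= add1n addn_min_max.
Qed.

Lemma perm_reflect (T := [seq t <- strips l | u \in strips t]) :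
  perm_eq (map reflect_strip T) T.
Proof.
have memT t : (t \in T) = (t \in strips l) && (u \in strips t).
  by rewrite mem_filter andbC.
have inj : {in T &, injective reflect_strip}.
  by move=> t t'; rewrite !memT => ht ht' /(congr1 reflect_strip);
    rewrite !reflectK.
apply: uniq_perm; rewrite ?map_inj_in_uniq ?filter_uniq ?strips_uniq // => t.
apply/mapP/idP => [[t' ht' ->]|ht]; first by move: ht'; rewrite !memT;
  apply: reflect_between.
rewrite memT in ht.
by exists (reflect_strip t); rewrite ?reflectK // memT reflect_between.
Qed.

End Reflection.

(** The symmetry of Schur functions in two adjacent variables, in a form that
    serves both for counting tableaux and for listing their weights. *)
Lemma strips_swap (G : nat -> nat -> seq nat -> nat) l :
  \sum_(t <- strips l) \sum_(u <- strips t)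
     G (sumn l - sumn t) (sumn t - sumn u) u =
  \sum_(t <- strips l) \sum_(u <- strips t)
     G (sumn t - sumn u) (sumn l - sumn t) u.
Proof.
pose U := undup (flatten [seq strips t | t <- strips l]).
have exch (F : seq nat -> seq nat -> nat) :
    \sum_(t <- strips l) \sum_(u <- strips t) F t u =
    \sum_(u <- U) \sum_(t <- [seq t <- strips l | u \in strips t]) F t u.
  under [RHS]eq_bigr do rewrite big_filter.
  rewrite (exchange_big_dep xpredT) //=; apply: eq_big_seq => t tl.
  rewrite -[RHS]big_filter; apply: perm_big; apply: uniq_perm;
    rewrite ?strips_uniq ?filter_uniq ?undup_uniq //.
  move=> u; rewrite mem_filter mem_undup;
    case: (boolP (u \in strips t)) => //= hu.
  by apply/esym/flattenP; exists (strips t); rewrite ?map_f.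
rewrite !exch; apply: eq_bigr => u _.
rewrite -(perm_big _ (perm_reflect l u)) big_map; apply: eq_big_seq => t.
rewrite mem_filter andbC => ht; have := sumn_reflect ht.
case/andP: ht => /strips_sumn le1 /strips_sumn le2 e.
by congr G; lia.
Qed.

Lemma strips_rcons0 l : strips (rcons l 0) = [seq rcons t 0 | t <- strips l].
Proof.
elim: l => //= a l IH; rewrite IH.
have ->: head 0 (rcons l 0) = head 0 l by case: l {IH}.
by elim: (index_iota _ _) => //= b s ->; rewrite map_cat -!map_comp.
Qed.

Lemma sumn_rcons0 l : sumn (rcons l 0) = sumn l.
Proof. by rewrite sumn_rcons addn0. Qed.

Lemma strips_consP a l t : t \in strips (a :: l) ->
  exists b t', [/\ t = b :: t', head 0 l <= b <= a & t' \in strips l].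
Proof.
case/allpairsP=> [[b t'] [hb ht ->]]; exists b, t'; split=> //.
by rewrite mem_index_iota ltnS in hb.
Qed.

#[global] Arguments strips : simpl never.

(** A horizontal strip has at most one box in each of the a columns of the
    shape a :: l, and it has one in every column only if it removes the
    bottom box of each of them. What is left is then l: the rows have moved
    up. *)
Lemma strips_behead a l t : t \in strips (a :: l) ->
  sumn (a :: l) - sumn t <= a /\
  (sumn (a :: l) - sumn t = a -> t = rcons l 0).
Proof.
elim: l a t => [|b l IH] a t.
  case/stripsP; case: t => [|c [|]] //= _ /(_ 0) /=; rewrite !addn0 => h.
  split=> [|e]; first by lia.
  by have ->: c = 0 by lia.
case/strips_consP=> c [t' [-> hc ht]].
have [le1 e1] := IH _ _ ht; have := strips_sumn ht; move: hc le1 e1 => /=.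
move=> hc le1 e1 le2; split=> [|e]; first by lia.
have ->: c = b by lia.
by congr cons; apply: e1; lia.
Qed.

Lemma rcons_strips a l : sorted geq (a :: l) -> rcons l 0 \in strips (a :: l).
Proof.
move/sorted_geqP=> h; apply/stripsP; split; first by rewrite size_rcons.
move=> i; have := h i; have -> : nth 0 (rcons l 0) i = nth 0 l i.
  by rewrite nth_rcons; case: ltngtP => // hi; rewrite nth_default ?hi // ltnW.
by rewrite /= leqnn.
Qed.

(** * Kostka numbers *)

(** Counts the tableaux of shape l by their chains of shapes. The letter
    whose multiplicity is listed first is the largest one, which is removed
    first. *)
Fixpoint kostka (l al : seq nat) : nat :=
  if al is a :: al' then
    \sum_(t <- strips l | sumn l - sumn t == a) kostka t al'
  else sumn l == 0.

Lemma kostka_perm l al be : perm_eq al be -> kostka l al = kostka l be.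
Proof.
move=> p; move: p l.
apply: (@perm_eq_ind_swap _ (fun al be => forall l, kostka l al = kostka l be))
  => //=.
- by move=> s1 s2 s3 h1 h2 l; rewrite h1.
- by move=> a s1 s2 h l; apply: eq_bigr => t _; apply: h.
move=> a b s l.
pose G i j u := if (i == a) && (j == b) then kostka u s else 0.
have two_steps a' b' :
    \sum_(t <- strips l | sumn l - sumn t == a')
       \sum_(u <- strips t | sumn t - sumn u == b') kostka u s =
    \sum_(t <- strips l) \sum_(u <- strips t)
       if (sumn l - sumn t == a') && (sumn t - sumn u == b') then kostka u s
       else 0.
  rewrite big_mkcond; apply: eq_bigr => t _.
  by case: eqP => _ /=; [rewrite big_mkcond | rewrite big1].
rewrite !two_steps; apply: etrans (strips_swap G l) _.
by do 2!(apply: eq_bigr => ? _); rewrite /G andbC.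
Qed.

Lemma kostka_rcons0 l al : kostka (rcons l 0) al = kostka l al.
Proof.
elim: al l => [|a al IH] l /=; rewrite ?sumn_rcons0 // strips_rcons0 big_map.
by apply: eq_big => t; rewrite ?sumn_rcons0.
Qed.

Lemma kostka0 l al : sorted geq l -> kostka l (0 :: al) = kostka l al.
Proof.
move=> sl /=; rewrite big_mkcond /= (bigD1_seq l) ?strips_refl ?strips_uniq //=.
rewrite subnn eqxx big1_seq ?addn0 // => t /andP[ne tl].
case: eqP => // e; case/eqP: ne; apply: (strips_sumn_eq tl).
by have := strips_sumn tl; lia.
Qed.

Lemma kostka_head a l al : sorted geq (a :: l) ->
  kostka (a :: l) (a :: al) = kostka l al.
Proof.
move=> sl; rewrite -(kostka_rcons0 l) [LHS]/= big_mkcond /=.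
rewrite (bigD1_seq (rcons l 0)) ?rcons_strips ?strips_uniq //=.
rewrite sumn_rcons0 addnK eqxx big1_seq ?addn0 // => t /andP[ne tl].
case: eqP => // e; case/eqP: ne; exact: (strips_behead tl).2.
Qed.

Lemma kostka_gt_head l a al : head 0 l < a -> kostka l (a :: al) = 0.
Proof.
case: l => [|b l] /= lt.
  by rewrite big1_seq // => t /andP[/eqP e] /strips_sumn; move: lt;
    rewrite -e /=; lia.
rewrite big1_seq // => t /andP[/eqP e tl].
by have [] := strips_behead tl; rewrite /= e => /(leq_trans lt); rewrite ltnn.
Qed.

Lemma kostka_sumn l al : kostka l al != 0 -> sumn al = sumn l.
Proof.
elim: al l => [|a al IH] l /=; first by case: (sumn l =P 0).
rewrite sum_nat_seq_neq0 => /hasP[t tl /andP[/eqP <- /IH ->]].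
by rewrite subnK // strips_sumn.
Qed.

Local Open Scope ring_scope.

(** * Schur functions of a finite list *)

Section TableauMonomials.
Variable R : comNzRingType.
Implicit Types (l t : seq nat) (L : seq R) (d : nat) (x y m : R).

(** The weights of the semistandard tableaux of shape l when the values of
    the letters are listed in L, the largest letter first. Letting these
    values lie in any commutative ring allows a weight to be itself the value
    of a letter, as plethysm requires. *)
Fixpoint tab_weights l L : seq R :=
  if L is x :: L' then
    [seq x ^+ (sumn l - sumn t) * m | t <- strips l, m <- tab_weights t L']
  else if sumn l == 0%N then [:: 1] else [::].

Definition schur_eval l L : R := \sum_(m <- tab_weights l L) m.

Lemma tab_weights_cons l x L :
  tab_weights l (x :: L) =
  [seq x ^+ (sumn l - sumn t) * m | t <- strips l, m <- tab_weights t L].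
Proof. by []. Qed.

Lemma count_tab_weights_cons a l x L :
  count a (tab_weights l (x :: L)) =
  (\sum_(t <- strips l)
     count (fun m => a (x ^+ (sumn l - sumn t) * m)%R) (tab_weights t L))%N.
Proof.
rewrite /= count_flatten sumnE !big_map; apply: eq_bigr => t _.
by rewrite count_map.
Qed.

Lemma schur_eval_cons l x L :
  schur_eval l (x :: L) =
  \sum_(t <- strips l) x ^+ (sumn l - sumn t) * schur_eval t L.
Proof.
rewrite /schur_eval /= big_allpairs_dep; apply: eq_bigr => t _.
by rewrite big_distrr.
Qed.

Lemma tab_weights_perm l L1 L2 :
  perm_eq L1 L2 -> perm_eq (tab_weights l L1) (tab_weights l L2).
Proof.
move=> p; move: p l.
apply: (@perm_eq_ind_swap _
  (fun L1 L2 => forall l, perm_eq (tab_weights l L1) (tab_weights l L2))) => //.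
- by move=> L L' L'' h1 h2 l; apply: perm_trans (h1 l) (h2 l).
- move=> x L L' h l; apply/seq.permP => a; rewrite !count_tab_weights_cons.
  by apply: eq_bigr => t _; have /seq.permP := h t; apply.
move=> x y L l; apply/seq.permP => a.
(* The weights with given strips filled by the two letters, counted together. *)
pose G i j u := count (fun m => a (x ^+ i * (y ^+ j * m))) (tab_weights u L).
rewrite !count_tab_weights_cons.
under eq_bigr do rewrite count_tab_weights_cons.
under [RHS]eq_bigr do rewrite count_tab_weights_cons.
apply: etrans (strips_swap G l) _.
by do 2!(apply: eq_bigr => ? _); apply: eq_count => m; rewrite mulrCA.
Qed.

Lemma schur_eval_perm l L1 L2 :
  perm_eq L1 L2 -> schur_eval l L1 = schur_eval l L2.
Proof. by move=> p; apply/perm_big/tab_weights_perm. Qed.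

Lemma tab_weights_rcons0 l L : tab_weights (rcons l 0%N) L = tab_weights l L.
Proof.
elim: L l => [|x L IH] l /=; rewrite ?sumn_rcons0 // strips_rcons0 -map_comp.
by congr flatten; apply: eq_map => t /=; rewrite sumn_rcons0 IH.
Qed.

Lemma schur_eval0 l L : sorted geq l -> schur_eval l (0 :: L) = schur_eval l L.
Proof.
move=> sl; rewrite schur_eval_cons (bigD1_seq l) ?strips_refl ?strips_uniq //=.
rewrite subnn mul1r big1_seq ?addr0 // => t /andP[ne tl].
rewrite expr0n; case: eqP => [e|_]; last by rewrite mul0r.
case/eqP: ne; apply: (strips_sumn_eq tl).
by have := strips_sumn tl; lia.
Qed.

Lemma schur_eval_filter0 l L : sorted geq l ->
  schur_eval l [seq x <- L | x != 0] = schur_eval l L.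
Proof.
elim: L l => //= x L IH l sl; case: eqP => [->|_] /=;
  first by rewrite schur_eval0 ?IH.
rewrite !schur_eval_cons; apply: eq_big_seq => t tl.
by rewrite IH ?(strips_sorted tl).
Qed.

(** In the list of weights of all tableaux, grouped by the shape left after
    the removal of one letter, only one group survives both the
    specialization of that letter to zero and the extraction of the highest
    power of it. *)
Lemma schur_eval_flatten (T : eqType) (s : seq T) (B : T -> seq R) j0 l :
  sorted geq l -> uniq s -> j0 \in s ->
  (forall j, j \in s -> j != j0 -> all (pred1 0) (B j)) ->
  schur_eval l (flatten [seq B j | j <- s]) = schur_eval l (B j0).
Proof.
move=> sl us j0s B0; rewrite -[LHS]schur_eval_filter0 //
  -[RHS]schur_eval_filter0 //.
congr schur_eval; rewrite filter_flatten -map_comp.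
have nz j : j \in s -> [seq y <- B j | y != 0] =
    if j == j0 then [seq y <- B j0 | y != 0] else [::].
  move=> js; case: eqP => [->//|/eqP ne].
  apply/eqP; rewrite -size_eq0 size_filter -leqn0 leqNgt -has_count.
  by apply/hasPn => y; rewrite negbK => /(allP (B0 j js ne)).
have /eq_in_map /= -> := nz.
elim: s us j0s {B0 nz} => //= j s IH /andP[js us]; rewrite inE eq_sym.
have [ej _|_ /= /IH ->//] := eqVneq j j0.
rewrite [X in _ ++ X](_ : _ = [::]) ?cats0 //; rewrite {}ej in js.
elim: s js {IH us} => //= k s IH; rewrite inE negb_or eq_sym =>
  /andP[/negPf -> /IH].
by [].
Qed.

(** D d x stands for x being homogeneous of degree d, in a grading or in a
    filtration. *)
Section Graded.
Variable D : nat -> R -> Prop.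
Hypothesis D1 : D 0%N 1.
Hypothesis DM : forall i j x y, D i x -> D j y -> D (i + j)%N (x * y).

Let DX d i x : D d x -> D (i * d)%N (x ^+ i).
Proof. by move=> Dx; elim: i => // i IH; rewrite exprS mulSn; apply: DM. Qed.

Lemma tab_weights_graded d l L : (forall x, x \in L -> D d x) ->
  forall m, m \in tab_weights l L -> D (sumn l * d)%N m.
Proof.
elim: L l => [|x L IH] l DL m /=.
  by case: eqP => // ->; rewrite inE => /eqP ->.
case/allpairsPdep=> t [m' [tl m't ->]].
have -> : (sumn l * d = (sumn l - sumn t) * d + sumn t * d)%N.
  by rewrite -mulnDl subnK // strips_sumn.
apply: DM.
  by apply: DX; apply: DL; rewrite mem_head.
by apply: IH => // y yL; apply: DL; rewrite inE yL orbT.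
Qed.

Lemma schur_eval_graded d l L :
  (forall i, D i 0) -> (forall i x y, D i x -> D i y -> D i (x + y)) ->
  (forall x, x \in L -> D d x) -> D (sumn l * d)%N (schur_eval l L).
Proof.
move=> D0 DD DL; rewrite /schur_eval big_seq_cond.
by elim/big_rec: _ => // m z; rewrite andbT => /(tab_weights_graded DL);
  apply: DD.
Qed.

End Graded.
End TableauMonomials.

Lemma tab_weights_map (R S : comNzRingType) (f : {rmorphism R -> S}) l L :
  tab_weights l (map f L) = map f (tab_weights l L).
Proof.
elim: L l => [|x L IH] l /=; first by case: eqP => //=; rewrite rmorph1.
rewrite map_flatten -map_comp; congr flatten; apply: eq_map => t /=.
by rewrite IH -!map_comp; apply: eq_map => m /=; rewrite rmorphM rmorphXn.
Qed.

Lemma schur_eval_map (R S : comNzRingType) (f : {rmorphism R -> S}) l L :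
  schur_eval l (map f L) = f (schur_eval l L).
Proof. by rewrite /schur_eval tab_weights_map big_map rmorph_sum. Qed.

Section Top.
Variable S : comNzRingType.

(** Carrying the coefficient in degree d along with the polynomial, in a
    product ring, makes this relation multiplicative also when that
    coefficient is 0. *)
Definition has_top (d : nat) (z : {poly S} * S) :=
  (size z.1 <= d.+1)%N /\ z.1`_d = z.2.

Lemma has_topM i j z w :
  has_top i z -> has_top j w -> has_top (i + j)%N (z * w).
Proof.
case: z w => [p a] [q b] [/= sp <-] [/= sq <-]; split=> /=.
  apply: leq_trans (size_polyMleq _ _) _; rewrite -subn1 leq_subLR add1n.
  by apply: leq_trans (leq_add sp sq) _; rewrite addSn addnS.
have lt_ij : (i < (i + j).+1)%N by rewrite ltnS leq_addr.
rewrite coefM (bigD1 (Ordinal lt_ij)) //= addKn big1 ?addr0 // => k ne.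
have {}ne : (k : nat) != i by [].
case: (ltnP i k) => hk;
  first by rewrite [p`__]nth_default ?mul0r // (leq_trans sp).
by rewrite [q`__]nth_default ?mulr0 // (leq_trans sq) //; lia.
Qed.

(** The key computation. Each weight of shape r :: l has degree at most r in
    the new variable, with leading coefficient a weight of shape l if r is
    reached, and 0 otherwise; evaluating s_nu commutes with taking leading
    coefficients, and zero values can be dropped from the list. *)
Lemma has_top_plethysm nu l r (L : seq S) :
  sorted geq nu -> sorted geq (r :: l) ->
  has_top (sumn nu * r)%N
    (schur_eval nu (tab_weights (r :: l) ('X :: map polyC L)),
     schur_eval nu (tab_weights l L)).
Proof.
move=> snu sl; pose e t := (sumn (r :: l) - sumn t)%N.
(* Weights paired with their coefficients in degree r. *)
pose Z : seq ({poly S} * S)%type :=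
  [seq ('X ^+ e t * m%:P, if e t == r then m else 0)
     | t <- strips (r :: l), m <- tab_weights t L].
have eZ1 : tab_weights (r :: l) ('X :: map polyC L) = map fst Z.
  rewrite tab_weights_cons /Z [RHS]map_flatten -[in RHS]map_comp; congr flatten.
  by apply: eq_map => t /=; rewrite tab_weights_map -!map_comp.
have eZ2 : schur_eval nu (tab_weights l L) = schur_eval nu (map snd Z).
  rewrite /Z map_flatten -map_comp -(tab_weights_rcons0 l).
  rewrite (schur_eval_flatten snu (strips_uniq _) (rcons_strips sl)).
    congr schur_eval; rewrite /= -map_comp -[LHS]map_id; apply: eq_map => m /=.
    by rewrite /e sumn_rcons0 /= addnK eqxx.
  move=> t tl ne; rewrite /= -map_comp all_map; apply/allP => m _ /=.
  case: (e t =P r) => // et; case/eqP: ne; exact: (strips_behead tl).2.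
rewrite eZ1 eZ2 (schur_eval_map fst) (schur_eval_map snd) -surjective_pairing.
apply: schur_eval_graded.
- by split=> /=; rewrite ?size_poly1 // coef1.
- exact: has_topM.
- by move=> i; split=> /=; rewrite ?size_poly0 // coef0.
- move=> i [p a] [q b] [/= sp <-] [/= sq <-]; split=> /=; last by rewrite coefD.
  by apply: leq_trans (size_polyD _ _) _; rewrite geq_max sp sq.
move=> z /allpairsPdep[t [m [tl _ ->]]]; split=> /=.
  apply: leq_trans (size_polyMleq _ _) _; rewrite size_polyXn /= -addn1.
  by rewrite leq_add ?size_polyC_leq1 //; apply: (strips_behead tl).1.
by rewrite coefMC coefXn eq_sym; case: eqP; rewrite ?mul1r ?mul0r.
Qed.

End Top.

Lemma schur_eval_X (S : comNzRingType) l (L : seq S) k :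
  (schur_eval l ('X :: map polyC L))`_k =
  \sum_(t <- strips l | (sumn l - sumn t == k)%N) schur_eval t L.
Proof.
rewrite schur_eval_cons coef_sum [RHS]big_mkcond; apply: eq_bigr => t _.
rewrite (schur_eval_map polyC) coefMC coefXn eq_sym.
by case: eqP; rewrite ?mul1r ?mul0r.
Qed.

(** The constant coefficient is the value at 0, where only the tableaux
    without the new letter have a nonzero weight. *)
Lemma plethysm_const_coef (S : comNzRingType) nu l (L : seq S) :
  sorted geq nu -> sorted geq l ->
  (schur_eval nu (tab_weights l ('X :: map polyC L)))`_0 =
  schur_eval nu (tab_weights l L).
Proof.
move=> snu sl; rewrite -horner_coef0 -/(horner_eval 0 _) -schur_eval_map
  -tab_weights_map.
rewrite /= /horner_eval hornerX -map_comp (eq_map (g := id)); last first.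
  by move=> x /=; rewrite hornerC.
rewrite map_id (schur_eval_flatten snu (strips_uniq _) (strips_refl sl)).
  by rewrite subnn -[tab_weights l L in RHS]map_id; congr schur_eval;
    apply: eq_map => m; rewrite mul1r.
move=> t tl ne; rewrite all_map; apply/allP => m _ /=.
rewrite expr0n; case: (_ =P 0%N) => [e|_]; last by rewrite mul0r.
case/eqP: ne; apply: (strips_sumn_eq tl).
by have := strips_sumn tl; lia.
Qed.

(** * Coefficients of Schur functions and of plethysms *)

Definition mnm_of_seq N (al : seq nat) : 'X_{1..N} :=
  [multinom nth 0%N al i | i < N].

Lemma mnm_of_seqE N al i : mnm_of_seq N al i = nth 0%N al i.
Proof. exact: mnmE. Qed.

Definition mpvars N : seq {mpoly int[N]} := [seq 'X_i | i <- enum 'I_N].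

Section SplitFirst.
Variable N : nat.

(** Polynomials in N + 1 variables seen as polynomials in the first
    variable. *)
Definition split_first : {mpoly int[N.+1]} -> {poly {mpoly int[N]}} :=
  mmap (polyC \o @mpolyC N int)
       (fun i => if unlift ord0 i is Some j then ('X_j)%:P else 'X).

HB.instance Definition _ := GRing.RMorphism.on split_first.

Lemma split_firstX : map split_first (mpvars N.+1) = 'X :: map polyC (mpvars N).
Proof.
rewrite /mpvars enum_ordSl /= /split_first mmapX mmap1U unlift_none; congr cons.
by rewrite -!map_comp; apply: eq_map => i /=; rewrite mmapX mmap1U liftK.
Qed.

Lemma coef_split_first p a al :
  ((split_first p)`_a)@_(mnm_of_seq N al) = p@_(mnm_of_seq N.+1 (a :: al)).
Proof.
rewrite [p]mpolyE raddf_sum coef_sum !raddf_sum /=; apply: eq_bigr => m _.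
rewrite /split_first mmapZ coefCM mul_mpolyC !mcoeffZ; congr (_ * _).
rewrite mmapX /mmap1 big_ord_recl unlift_none.
under eq_bigr do rewrite liftK -rmorphXn.
rewrite -rmorph_prod /= coefMC coefXn mulr_natl raddfMn /=.
have -> : \prod_(i < N) 'X_i ^+ m (lift ord0 i) =
    'X_[int, [multinom m (lift ord0 i) | i < N]].
  by rewrite mpolyXE_id; apply: eq_bigr => i _; rewrite mnmE.
rewrite !mcoeffX.
have -> : (m == mnm_of_seq N.+1 (a :: al)) =
    (a == m ord0) && ([multinom m (lift ord0 i) | i < N] == mnm_of_seq N al).
  apply/eqP/andP => [->|[/eqP -> /eqP/mnmP e]].
    by split; apply/eqP; [rewrite mnm_of_seqE | apply/mnmP => i;
      rewrite mnmE !mnm_of_seqE].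
  apply/mnmP => i; rewrite mnm_of_seqE; case: (unliftP ord0 i) => [j|] -> //=.
  by have := e j; rewrite mnmE mnm_of_seqE.
by case: (a == m ord0); rewrite ?mulr1n ?mulr0n.
Qed.

End SplitFirst.

Lemma coef_schur_eval l al :
  (schur_eval l (mpvars (size al)))@_(mnm_of_seq (size al) al) =
  (kostka l al)%:R.
Proof.
elim: al l => [|a al IH] l /=.
  rewrite /schur_eval /mpvars enum_ord0 /=; case: eqP => _;
    last by rewrite big_nil mcoeff0.
  by rewrite big_seq1 mcoeff1 (nvar0_mnmE (mnm_of_seq 0 [::])) eqxx.
rewrite -coef_split_first -schur_eval_map split_firstX schur_eval_X.
by rewrite raddf_sum /= natr_sum; apply: eq_bigr.
Qed.

(** The number of variables is dictated by the list of exponents. No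
    information is lost: for partitions, the coefficient does not change when a zero
    exponent is added (plethysm_coef0). *)
Definition plethysm_coef nu l al : int :=
  (schur_eval nu (tab_weights l (mpvars (size al))))@_(mnm_of_seq (size al) al).

Lemma plethysm_coef_cons nu l a al :
  plethysm_coef nu l (a :: al) =
  ((schur_eval nu (tab_weights l
      ('X :: map polyC (mpvars (size al)))))`_a)@_(mnm_of_seq (size al) al).
Proof.
by rewrite /plethysm_coef -coef_split_first -schur_eval_map -tab_weights_map
  split_firstX.
Qed.

Lemma plethysm_coef0 nu l al : sorted geq nu -> sorted geq l ->
  plethysm_coef nu l (0%N :: al) = plethysm_coef nu l al.
Proof. by move=> snu sl; rewrite plethysm_coef_cons plethysm_const_coef. Qed.

Lemma plethysm_coef_top nu l r al : sorted geq nu -> sorted geq (r :: l) ->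
  plethysm_coef nu (r :: l) (sumn nu * r :: al)%N = plethysm_coef nu l al.
Proof.
move=> snu sl; rewrite plethysm_coef_cons.
by have [_ /= ->] := has_top_plethysm (mpvars (size al)) snu sl.
Qed.

Lemma plethysm_coef_gt nu l r a al : sorted geq nu -> sorted geq (r :: l) ->
  (sumn nu * r < a)%N -> plethysm_coef nu (r :: l) (a :: al) = 0.
Proof.
move=> snu sl lt; rewrite plethysm_coef_cons.
have [/= sz _] := has_top_plethysm (mpvars (size al)) snu sl.
by rewrite nth_default ?mcoeff0 // (leq_trans sz).
Qed.

Lemma plethysm_coef_homog nu l al :
  plethysm_coef nu l al != 0 -> sumn al = (sumn nu * sumn l)%N.
Proof.
set N := size al; pose D d (p : {mpoly int[N]}) : Prop := p \is d.-homog.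
have D1 : D 0%N 1 by apply: dhomog1.
have DM i j p q : D i p -> D j q -> D (i + j)%N (p * q) by apply: dhomogM.
have /dhomogP hom : D (sumn nu * sumn l)%N (schur_eval nu (tab_weights l
  (mpvars N))).
  apply: schur_eval_graded => //.
  - by move=> i; apply: dhomog0.
  - by move=> i p q; apply: dhomogD.
  rewrite -[sumn l]muln1; apply: tab_weights_graded => // x /mapP[i _ ->].
  by rewrite /D dhomogX; apply/eqP/mdeg1.
rewrite /plethysm_coef -/N -mcoeff_msupp => /hom /= <-.
rewrite mdegE sumnE (big_nth 0%N) big_mkord; apply: eq_bigr => i _.
by rewrite mnm_of_seqE.
Qed.

Lemma plethysm_coef_perm nu l al be :
  perm_eq al be -> plethysm_coef nu l al = plethysm_coef nu l be.
Proof.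
move=> pm; have sz := perm_size pm; move: pm.
rewrite /plethysm_coef -sz; set N := size al.
have szb : size be == N by rewrite -sz.
have -> : al = in_tuple al by [].
have -> : be = Tuple szb by [].
case/tuple_permP=> s e; set p := schur_eval _ _.
have -> : mnm_of_seq N (in_tuple al) =
    [multinom (mnm_of_seq N (Tuple szb)) (s i) | i < N].
  apply/mnmP => i; rewrite mnmE !mnm_of_seqE e /= (nth_map i) ?size_enum_ord //.
  by rewrite (tnth_nth 0%N) /= nth_ord_enum.
rewrite -mcoeff_sym; congr mcoeff.
rewrite -schur_eval_map -tab_weights_map; apply: schur_eval_perm;
  apply: tab_weights_perm.
have -> : map (msym s) (mpvars N) = [seq 'X_i | i <- map s (enum 'I_N)].
  rewrite /mpvars -!map_comp; apply: eq_map => i /=.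
  by rewrite /msym mmapX mmap1U.
apply: perm_map; apply: uniq_perm; rewrite ?(map_inj_uniq perm_inj) ?enum_uniq
  //.
move=> i; rewrite (mem_enum xpredT); apply/mapP; exists (s^-1 i)%g;
  by rewrite ?(mem_enum xpredT) ?permKV.
Qed.

(** * Semistandard tableaux *)

(** Boxes and tableaux for any list of row lengths, because the shapes in a
    chain can have trailing zeros. For a partition these are convertible to
    box and ssyt. *)
Definition sbox (l : seq nat) := {i : 'I_(size l) & 'I_(nth 0%N l i)}.
Definition box_row (l : seq nat) (b : sbox l) : nat := tag b.
Definition box_col (l : seq nat) (b : sbox l) : nat := tagged b.

Definition sst (l : seq nat) (N : nat) : {set {ffun sbox l -> 'I_N}} :=
  [set t : {ffun sbox l -> 'I_N} | [forall b, forall c,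
    ((box_row b == box_row c) && (box_col b < box_col c) ==> (t b <= t c))%N &&
    ((box_col b == box_col c) && (box_row b < box_row c) ==> (t b < t c))%N]].

Lemma sstP l N (t : {ffun sbox l -> 'I_N}) :
  reflect (forall b c,
    (box_row b = box_row c -> (box_col b < box_col c)%N -> (t b <= t c)%N) /\
    (box_col b = box_col c -> (box_row b < box_row c)%N -> (t b < t c)%N))
  (t \in sst l N).
Proof.
rewrite inE; apply: (iffP idP) => [/forallP h b c|h].
  have /forallP/(_ c)/andP[/implyP h1 /implyP h2] := h b.
  by split=> e lt; [apply: h1 | apply: h2]; rewrite e eqxx.
apply/forallP=> b; apply/forallP=> c; have [h1 h2] := h b c.
by apply/andP; split; apply/implyP => /andP[/eqP e lt]; [apply: h1 | apply: h2].
Qed.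

Lemma box_col_lt l (b : sbox l) : (box_col b < nth 0%N l (box_row b))%N.
Proof. exact: ltn_ord. Qed.

Lemma box_ex l i j : (j < nth 0%N l i)%N ->
  exists b : sbox l, box_row b = i /\ box_col b = j.
Proof.
move=> hj; have hi : (i < size l)%N.
  by rewrite ltnNge; apply/negP => /(nth_default 0%N) e; rewrite e in hj.
by exists (Tagged (fun i : 'I_(size l) => 'I_(nth 0%N l i))
  (Ordinal (hj : (j < nth 0%N l (Ordinal hi))%N))).
Qed.

Lemma box_inj l (b c : sbox l) :
  box_row b = box_row c -> box_col b = box_col c -> b = c.
Proof.
case: b c => [i j] [i' j'] /= /val_inj e; rewrite /box_row /= in e; subst i'.
by move=> /val_inj e; rewrite /box_col /= in e; subst j'.
Qed.

Lemma card_sbox l : #|{: sbox l}| = sumn l.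
Proof.
rewrite card_tagged sumnE big_map big_enum /= (sumn_nth (leqnn (size l))).
by apply: eq_bigr => i _; rewrite card_ord.
Qed.

Section FillMax.
Variables (l k : seq nat) (N : nat).

(** The tableaux of shape l in the letters 0, ..., N are the tableaux of the
    shapes k in strips l in the letters 0, ..., N - 1, filled up with N. *)
Definition fill_max (t : {ffun sbox k -> 'I_N}) : {ffun sbox l -> 'I_N.+1} :=
  [ffun b =>
     if [pick c : sbox k | (box_row c == box_row b) && (box_col c == box_col b)]
       is Some c then widen_ord (leqnSn N) (t c) else ord_max].

Lemma fill_max_in t b c : box_row c = box_row b -> box_col c = box_col b ->
  fill_max t b = t c :> nat.
Proof.
move=> er ec; rewrite ffunE; case: pickP => [c' /andP[/eqP er' /eqP ec']|/(_
  c)].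
  by rewrite (@box_inj _ c' c) // ?er' ?ec'.
by rewrite er ec !eqxx.
Qed.

Lemma fill_max_out t b :
  (nth 0%N k (box_row b) <= box_col b)%N -> fill_max t b = N :> nat.
Proof.
move=> le; rewrite ffunE; case: pickP => //= c /andP[/eqP er /eqP ec].
by have := box_col_lt c; rewrite er ec ltnNge le.
Qed.

Hypothesis kl : k \in strips l.

Let kl_le i : (nth 0 l i.+1 <= nth 0 k i <= nth 0 l i)%N.
Proof. by case/stripsP: kl. Qed.

Lemma fill_max_sst t : sorted geq l -> t \in sst k N -> fill_max t \in sst l
  N.+1.
Proof.
move=> sl /sstP ht; have sk := strips_sorted kl; apply/sstP=> b c.
have [lt_c|le_c] := ltnP (box_col c) (nth 0%N k (box_row c)).
  have [c' [rc cc]] := box_ex lt_c; rewrite (fill_max_in t rc cc).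
  split=> e lt.
    have [b' [rb cb]] := box_ex (ltn_trans lt lt_c); rewrite -e in rb.
    by rewrite (fill_max_in t rb cb); apply: (ht b' c').1;
      rewrite ?cb ?cc // rb rc.
  have lt_b : (box_col b < nth 0%N k (box_row b))%N.
    by rewrite e (leq_trans lt_c) // nth_sorted_geq // ltnW.
  have [b' [rb cb]] := box_ex lt_b.
  by rewrite (fill_max_in t rb cb); apply: (ht b' c').2;
    rewrite ?rb ?rc // cb cc.
rewrite (fill_max_out t le_c); split=> [_ _|e lt]; first by rewrite -ltnS.
have lt_b : (box_col b < nth 0%N k (box_row b))%N.
  rewrite e (leq_trans (box_col_lt c)) //; have /andP[+ _] := kl_le (box_row b).
  by apply: leq_trans; apply: nth_sorted_geq.
by have [b' [rb cb]] := box_ex lt_b; rewrite (fill_max_in t rb cb).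
Qed.

Lemma prod_fill_max (R : comNzRingType) (v : nat -> R) t :
  \prod_b v (fill_max t b) = v N ^+ (sumn l - sumn k) * \prod_c v (t c).
Proof.
have /fin_all_exists[emb embP] : forall c : sbox k,
    exists b : sbox l, box_row b = box_row c /\ box_col b = box_col c.
  move=> c; apply: box_ex; apply: leq_trans (box_col_lt c) _.
  by case/andP: (kl_le (box_row c)).
have emb_inj : injective emb.
  move=> c c' e; have [r1 c1] := embP c; have [r2 c2] := embP c'.
  by apply: box_inj; rewrite -?r1 -?r2 -?c1 -?c2 e.
pose A := emb @: [set: sbox k]; rewrite (bigID (mem A)) /= mulrC; congr (_ * _).
  rewrite (eq_bigr (fun=> v N)) => [|b bA]; last first.
    congr v; apply: fill_max_out; rewrite leqNgt; apply: contra bA => lt_b.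
    have [c [rc cc]] := box_ex lt_b; apply/imsetP; exists c => //.
    by have [r1 c1] := embP c; apply: box_inj; rewrite ?r1 ?c1.
  rewrite (eq_bigl (mem (~: A))) => [|b]; last by rewrite !inE.
  by rewrite prodr_const cardsCs setCK card_sbox card_imset // cardsT card_sbox.
rewrite big_imset => [|c c' _ _]; last exact: emb_inj.
apply: eq_big => [c|c _]; first by rewrite inE.
by have [rc cc] := embP c; rewrite (@fill_max_in _ _ c).
Qed.

End FillMax.

(** The shape to start from is formed by the entries smaller than N, which
    come first in each row. *)
Lemma fill_max_surj l N t : sorted geq l -> t \in sst l N.+1 ->
  exists k t', [/\ k \in strips l, t' \in sst k N & t = fill_max l t'].
Proof.
move=> sl /sstP ht.
(* k_i is the first column of row i with the entry N, or l_i without any. *)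
pose p i j :=
  [exists b : sbox l, [&& box_row b == i, box_col b == j & t b == N :> nat]].
pose k := mkseq (fun i => find (p i) (iota 0 (nth 0%N l i))) (size l).
have kE i : nth 0%N k i = find (p i) (iota 0 (nth 0%N l i)).
  case: (ltnP i (size l)) => hi; first by rewrite nth_mkseq.
  by rewrite !nth_default ?size_mkseq.
have k_le i : (nth 0 k i <= nth 0 l i)%N.
  by rewrite kE -[X in (_ <= X)%N](size_iota 0); apply: find_size.
have k_lt (b : sbox l) : (t b < N)%N = (box_col b < nth 0 k (box_row b))%N.
  have lt_b := box_col_lt b; apply/idP/idP => [tb|].
    rewrite ltnNge; apply/negP => le_k.
    have lt_k := leq_ltn_trans le_k lt_b.
    have : p (box_row b) (nth 0%N k (box_row b)).
      have /(nth_find 0%N) :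
          has (p (box_row b)) (iota 0 (nth 0%N l (box_row b))).
        by rewrite has_find size_iota -kE.
      by rewrite nth_iota -kE.
    case/existsP=> c /and3P[/eqP rc /eqP cc /eqP tc].
    move: le_k; rewrite leq_eqVlt => /orP[/eqP e|lt].
      by rewrite -(@box_inj _ c b) ?tc ?ltnn // ?cc in tb.
    have := (ht c b).1 rc; rewrite cc tc => /(_ lt).
    by rewrite leqNgt tb.
  rewrite kE => /(before_find 0%N); rewrite nth_iota ?add0n // =>
    /negbT/existsPn/(_ b).
  by rewrite !eqxx /= => ne; rewrite ltn_neqAle ne -ltnS ltn_ord.
have kl : k \in strips l.
  apply/stripsP; split=> [|i]; first by rewrite size_mkseq.
  rewrite k_le andbT leqNgt; apply/negP => lt.
  have [c [rc cc]] := box_ex lt.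
  have [b [rb cb]] := box_ex (leq_trans lt ((sorted_geqP _ sl) i)).
  have := k_lt b; rewrite rb cb ltnn => /negbT; rewrite -leqNgt => le.
  have := (ht b c).2; rewrite cb cc rb rc => /(_ erefl (ltnSn _)) lt2.
  by have := ltn_ord (t c); rewrite ltnS leqNgt (leq_ltn_trans le lt2).
have /fin_all_exists[t' t'P] : forall c : sbox k, exists y : 'I_N,
    forall b : sbox l,
      box_row b = box_row c -> box_col b = box_col c -> t b = y :> nat.
  move=> c.
  have [b [rb cb]] := box_ex (leq_trans (box_col_lt c) (k_le (box_row c))).
  have tb : (t b < N)%N by rewrite k_lt rb cb box_col_lt.
  by exists (Ordinal tb) => b' r' c'; rewrite (@box_inj _ b' b) // ?r' ?c'.
have ex_l (c : sbox k) := box_ex (leq_trans (box_col_lt c) (k_le (box_row c))).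
exists k, [ffun c => t' c]; split=> //.
  apply/sstP=> c c'; have [b [rb cb]] := ex_l c; have [b' [rb' cb']] := ex_l c'.
  rewrite !ffunE -(t'P c b) // -(t'P c' b') //.
  by have := ht b b'; rewrite rb cb rb' cb'.
apply/ffunP => b; apply: val_inj => /=.
have [lt|le] := ltnP (box_col b) (nth 0%N k (box_row b)).
  by have [c [rc cc]] := box_ex lt; rewrite (@fill_max_in _ _ _ _ b c) //
    ffunE; apply: t'P.
rewrite fill_max_out //; apply/eqP; rewrite eqn_leq -ltnS ltn_ord /= leqNgt
  k_lt.
by rewrite -leqNgt.
Qed.

Lemma fill_max_inj l N k1 k2
    (t1 : {ffun sbox k1 -> 'I_N}) (t2 : {ffun sbox k2 -> 'I_N}) :
  k1 \in strips l -> k2 \in strips l -> fill_max l t1 = fill_max l t2 ->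
  Tagged (fun k => {ffun sbox k -> 'I_N}) t1 =
  Tagged (fun k => {ffun sbox k -> 'I_N}) t2.
Proof.
move=> kl1 kl2 e.
have le ka kb (ta : {ffun sbox ka -> 'I_N}) (tb : {ffun sbox kb -> 'I_N}) i :
    kb \in strips l -> fill_max l ta = fill_max l tb ->
    (nth 0 kb i <= nth 0 ka i)%N.
  move=> /stripsP[_ h] eab; rewrite leqNgt; apply/negP => lt.
  have [c [rc cc]] := box_ex lt.
  have /box_ex[b [rb cb]] : (nth 0 ka i < nth 0 l i)%N.
    by apply: leq_trans lt _; case/andP: (h i).
  have /(congr1 val) /= := congr1 (fun f : {ffun _ -> 'I_N.+1} => f b) eab.
  rewrite fill_max_out ?rb ?cb // (@fill_max_in _ _ _ _ b c) ?rb ?cb // => eN.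
  by have := ltn_ord (tb c); rewrite -eN ltnn.
have ek : k1 = k2.
  have [[s1 _] [s2 _]] := (stripsP _ _ kl1, stripsP _ _ kl2).
  apply: (@eq_from_nth _ 0%N) => [|i _]; first by rewrite s1 s2.
  by apply/eqP; rewrite eqn_leq (le _ _ t1 t2) ?(le _ _ t2 t1).
subst k2; congr existT; apply/ffunP => c; apply: val_inj => /=.
have [b [rb cb]] : exists b : sbox l,
    box_row b = box_row c /\ box_col b = box_col c.
  apply: box_ex; apply: leq_trans (box_col_lt c) _.
  by case/stripsP: kl1 => _ /(_ (box_row c))/andP[].
have /(congr1 val) /= := congr1 (fun f : {ffun _ -> 'I_N.+1} => f b) e.
by rewrite !(@fill_max_in _ _ _ _ b c).
Qed.

Lemma perm_sst_fill_max l N : sorted geq l ->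
  perm_eq (enum (sst l N.+1))
    [seq fill_max l t | k <- strips l, t <- enum (sst k N)].
Proof.
move=> sl; apply: uniq_perm; first exact: enum_uniq.
  apply: allpairs_uniq_dep => [|k _|]; rewrite ?strips_uniq ?enum_uniq //.
  move=> _ _ /allpairsPdep[k1 [t1 [kl1 _ ->]]] /allpairsPdep[k2 [t2 [kl2 _
    ->]]] /=.
  exact: fill_max_inj.
move=> t; rewrite mem_enum; apply/idP/allpairsPdep => [/(fill_max_surj sl)|].
  by case=> k [t' [kl ht ->]]; exists k, t'; rewrite mem_enum.
by case=> k [t' [kl + ->]]; rewrite mem_enum; apply: fill_max_sst.
Qed.

(** This is an equality of multisets, rather than of sums, because all the
    weights individually are arguments of the outer function of a plethysm. *)
Lemma perm_sst_tab_weights (R : comNzRingType) (v : nat -> R) l N :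
  sorted geq l ->
  perm_eq [seq \prod_b v (t b) | t : {ffun sbox l -> 'I_N} <- enum (sst l N)]
          (tab_weights l [seq v i | i <- rev (iota 0 N)]).
Proof.
elim: N l => [|N IH] l sl.
  rewrite /=; have [l0|/eqP l0] := eqP.
    have nobox (b : sbox l) : False by have := fintype0 b; rewrite card_sbox.
    have -> : sst l 0 = [set: {ffun sbox l -> 'I_0}].
      by apply/setP => t; rewrite [RHS]inE; apply/sstP => b; case: (nobox b).
    have /eqP := card_ffun (sbox l) 'I_0;
      rewrite card_ord card_sbox l0 expn0 => c1.
    rewrite (eq_map (g := fun=> 1)) => [|t]; last by rewrite big1 // => b;
      case: (nobox b).
    have : size (enum [set: {ffun sbox l -> 'I_0}]) = 1%N.
      by rewrite -cardE cardsT (eqP c1).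
    by case: (enum _) => [|t []].
  have -> : sst l 0 = set0.
    apply/setP => t; rewrite [RHS]inE; apply/negbTE/negP => _.
    have /card_gt0P[b _] : (0 < #|{: sbox l}|)%N by rewrite card_sbox lt0n.
    by case: (t b).
  by rewrite enum_set0.
have -> : rev (iota 0 N.+1) = N :: rev (iota 0 N).
  by rewrite -addn1 iotaD rev_cat.
rewrite map_cons (permPl (perm_map _ (perm_sst_fill_max N sl))).
apply/seq.permP => a; rewrite count_tab_weights_cons map_flatten count_flatten
  -!map_comp.
rewrite sumnE big_map; apply: eq_big_seq => k kl /=.
rewrite -(seq.permP (IH k (strips_sorted kl))) -map_comp !count_map.
by apply: eq_count => t /=; rewrite (prod_fill_max kl).
Qed.

Lemma intpart_sorted (la : intpart) : sorted geq la.
Proof. by case/andP: (partsP la). Qed.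
#[local] Hint Resolve intpart_sorted : core.

Lemma prod_content la N (t : {ffun box la -> 'I_N}) :
  'X_[content t] = \prod_b (mpvars N)`_(t b).
Proof.
rewrite mpolyXE_id [RHS](partition_big (fun b => t b) xpredT) //=.
apply: eq_bigr => i _; rewrite mnmE -prodr_const; apply: eq_big => b;
  first by rewrite inE.
rewrite inE => /eqP ->; rewrite (nth_map i) ?size_enum_ord //.
by rewrite nth_ord_enum.
Qed.

Lemma perm_content_tab_weights (la : intpart) N :
  perm_eq [seq 'X_[content t] | t <- enum (ssyt la N)] (tab_weights la (mpvars
    N)).
Proof.
rewrite (eq_map (@prod_content la N)).
apply: perm_trans (perm_sst_tab_weights (fun i =>
  (mpvars N)`_i) N (intpart_sorted la)) _.
apply: tab_weights_perm; rewrite map_rev perm_rev.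
rewrite -[X in iota _ X](size_enum_ord N).
rewrite -(size_map (fun i : 'I_N => 'X_i : {mpoly int[N]})) -/(mkseq _ _).
by rewrite mkseq_nth.
Qed.

Lemma schurE (la : intpart) N : schur la N = schur_eval la (mpvars N).
Proof.
rewrite /schur /schur_eval -(perm_big _ (perm_content_tab_weights la N)) /=
  big_map.
by rewrite big_enum.
Qed.

Lemma plethysmE (nu mu : intpart) N :
  plethysm (schur nu) mu N = schur_eval nu (tab_weights mu (mpvars N)).
Proof.
rewrite /plethysm schurE -schur_eval_map; apply: schur_eval_perm.
apply: perm_trans (perm_content_tab_weights mu N); set T := mktuple _.
have -> : map (comp_mpoly T) (mpvars #|ssyt mu N|) =
          [seq 'X_[content t] | t <- enum (ssyt mu N)] => //.
apply: (@eq_from_nth _ 0) => [|i].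
  by rewrite /mpvars 2!size_map size_enum_ord size_map -cardE.
rewrite /mpvars 2!size_map size_enum_ord => hi.
rewrite -map_comp (nth_map (Ordinal hi)) ?size_enum_ord //=.
rewrite comp_mpolyXU (nth_enum_ord _ hi) -(tnth_nth 0 T (Ordinal hi))
  tnth_mktuple.
have t0 := enum_val (Ordinal hi).
by rewrite (nth_map t0) -?cardE // (enum_val_nth t0).
Qed.

Lemma mcoeff_seq N (p : {mpoly int[N]}) (m : 'X_{1..N}) :
  p@_m = p@_(mnm_of_seq N m).
Proof. by congr mcoeff; apply/mnmP => i; rewrite mnm_of_seqE -mnm_nth. Qed.

Lemma schur_coef (la : intpart) N al : size al = N ->
  (schur la N)@_(mnm_of_seq N al) = (kostka la al)%:R.
Proof. by move=> <-; rewrite schurE coef_schur_eval. Qed.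

Lemma plethysm_coefE (nu mu : intpart) N al : size al = N ->
  (plethysm (schur nu) mu N)@_(mnm_of_seq N al) = plethysm_coef nu mu al.
Proof. by move=> <-; rewrite plethysmE. Qed.

(** * Adding and removing a first row *)

Local Notation add_row r := (sqcup (row_part r)).

Lemma unrow_subproof (la : intpart) :
  sorted geq (behead la) && (0%N \notin behead la).
Proof.
have := partsP la; case: (parts la) => //= a l /andP[/path_sorted -> ].
by rewrite inE negb_or => /andP[].
Qed.

Definition unrow la : intpart := IntPart (unrow_subproof la).

Lemma head0_nil (la : intpart) : head 0%N la = 0%N -> la = row_part 0.
Proof.
case: la => [[|a l] p] /= e; apply: val_inj => //=.
by move: (p); rewrite e mem_head andbF.
Qed.

Lemma parts_sqcup r (la : intpart) : (head 0 la <= r)%N ->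
  add_row r la = nseq (0 < r) r ++ la :> seq nat.
Proof.
move=> le; apply: sorted_sort => [x y z xy yz|]; first exact: leq_trans yz xy.
case: r le => [|r] //=; have := intpart_sorted la.
by case: (parts la) => //= a l -> ->.
Qed.

Lemma head_sqcup r (la : intpart) : (head 0 la <= r)%N ->
  head 0%N (add_row r la) = r.
Proof.
by move=> le; rewrite parts_sqcup //; case: r le => //=; rewrite leqn0 => /eqP.
Qed.

(** When la has a part greater than r, the new row is not the first one. *)
Lemma head_le_sqcup r (la : intpart) :
  (head 0 la <= head 0 (add_row r la))%N.
Proof.
case e: (parts la) => [|a l] //; rewrite [head _ (_ :: _)]/=.
set mu := sqcup _ _.
have : a \in parts mu by rewrite mem_sort mem_cat e mem_head orbT.
move=> /(nthP 0%N)[i _ <-]; rewrite -nth0.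
by apply: nth_sorted_geq.
Qed.

Lemma sqcup_unrow (la : intpart) : add_row (head 0%N la) (unrow la) = la.
Proof.
apply: val_inj; rewrite /= -[LHS]/(parts (add_row (head 0%N la) (unrow la)))
  parts_sqcup.
  by have := partsP la; rewrite /=; case: (parts la) => [|[|a] l] //=;
    rewrite ?mem_head ?andbF.
by have /sorted_geqP/(_ 0%N) := intpart_sorted la; rewrite -nth_behead -!nth0.
Qed.

Lemma unrow_sqcup r (la : intpart) : (head 0 la <= r)%N ->
  unrow (add_row r la) = la.
Proof.
move=> le; apply: val_inj => /=; rewrite -[sort _ _]/(parts (add_row r la))
  parts_sqcup //.
case: r le => [|r] //=; rewrite leqn0 => /eqP/head0_nil ->.
by [].
Qed.

Lemma sumn_unrow (la : intpart) : (head 0%N la + sumn (unrow la))%N = sumn la.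
Proof. by case: la => [[|a l] p]. Qed.

Lemma kostka_unrow (la : intpart) al :
  kostka la (head 0%N la :: al) = kostka (unrow la) al.
Proof.
rewrite -[parts (unrow la)]/(behead la); have := intpart_sorted la.
case: (parts la) => [|a l] sl.
  by rewrite kostka0.
by rewrite kostka_head.
Qed.

Lemma head_le_sumn (la : intpart) : (head 0 la <= sumn la)%N.
Proof. by case: (parts la) => //= a l; apply: leq_addr. Qed.

Lemma sumn_add_row r (la : intpart) : (head 0 la <= r)%N ->
  sumn (add_row r la) = (r + sumn la)%N.
Proof. by move=> le; rewrite -sumn_unrow unrow_sqcup // head_sqcup. Qed.

Lemma kostka_add_row r (la : intpart) al : (head 0 la <= r)%N ->
  kostka (add_row r la) (r :: al) = kostka la al.
Proof. by move=> le; rewrite -{2}(head_sqcup le) kostka_unrow unrow_sqcup. Qed.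

(** * Integer combinations of Schur functions *)

Definition schur_comb (S : seq intpart) (c : intpart -> int) (al : seq nat) :=
  \sum_(ka <- S) c ka * (kostka ka al)%:R.

(** Extracting the highest power of one variable removes the first row from
    the Schur functions with the largest first part, and kills all the
    others. *)
Lemma schur_comb_top r (S : seq intpart) c al :
  (forall ka, ka \in S -> (head 0 (parts ka) <= r)%N) ->
  schur_comb S c (r :: al) =
  schur_comb [seq unrow ka | ka <- S & head 0%N (parts ka) == r]
    (c \o add_row r) al.
Proof.
move=> hS; rewrite /schur_comb big_map big_filter [RHS]big_mkcond.
apply: eq_big_seq => ka kaS; case: eqP => [e|ne].
  by rewrite -e kostka_unrow [(_ \o _) _]/= sqcup_unrow.
rewrite kostka_gt_head ?mulr0 //.
by rewrite ltn_neqAle hS // andbT; apply/eqP.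
Qed.

Lemma uniq_unrow r (S : seq intpart) : uniq S ->
  uniq [seq unrow ka | ka <- S & head 0%N (parts ka) == r].
Proof.
move=> uS; rewrite map_inj_in_uniq ?filter_uniq // => ka ka'.
rewrite !mem_filter => /andP[/eqP h _] /andP[/eqP h' _] e.
by rewrite -(sqcup_unrow ka) -(sqcup_unrow ka') h h' e.
Qed.

(** Linear independence of Schur functions. The partitions with the largest
    possible first part are dealt with by extracting the corresponding power
    of one variable, which lowers the degree; the others have a smaller bound
    on their first part. *)
Lemma schur_comb_eq0 S c : uniq S ->
  (forall al, schur_comb S c al = 0) -> forall ka, ka \in S -> c ka = 0.
Proof.
(* d bounds the degrees and K the first parts; the induction is on d + K. *)
suff main s : forall d K S c, (d + K < s)%N -> uniq S ->
    (forall ka : intpart, ka \in S -> (sumn ka <= d)%N && (head 0 ka <= K)%N) ->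
    (forall al, schur_comb S c al = 0) -> forall ka, ka \in S -> c ka = 0.
  move=> uS eS; pose d := \max_(ka <- S) sumn (parts ka).
  apply: (main (d + d).+1 d d S c) => // ka kaS.
  have le : (sumn ka <= d)%N by rewrite /d (big_rem ka kaS) leq_maxl.
  by rewrite le (leq_trans (head_le_sumn ka)).
elim: s => // s IH d [|K] {}S {}c lt uS bS eS.
  move=> ka kaS; have nilS k : k \in S -> k = row_part 0.
    by move/bS/andP => [_]; rewrite leqn0 => /eqP/head0_nil.
  have := eS [::]; rewrite /schur_comb (bigD1_seq ka) //= big1_seq ?addr0.
    by rewrite (nilS ka kaS) mulr1.
  by move=> k /andP[ne /nilS ek]; case/eqP: ne; rewrite ek (nilS ka kaS).
have top0 ka : ka \in S -> head 0%N ka = K.+1 -> c ka = 0.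
  move=> kaS ek; have led : (K.+1 <= d)%N.
    by rewrite -ek (leq_trans (head_le_sumn ka)) //; case/andP: (bS ka kaS).
  have -> : c ka = (c \o add_row K.+1) (unrow ka) by rewrite /= -ek sqcup_unrow.
  apply: (IH (d - K.+1)%N K.+1 _ (c \o add_row K.+1) _ (uniq_unrow K.+1 uS));
    first by lia.
  - move=> _ /mapP[k + ->]; rewrite mem_filter =>
    /andP[/eqP hk /bS/andP[b1 b2]].
    rewrite leq_subRL // -hk sumn_unrow b1 /=.
    have /sorted_geqP/(_ 0%N) := intpart_sorted k.
    by rewrite -nth_behead nth0 nth0.
  - move=> al; rewrite -schur_comb_top ?eS // => k /bS/andP[_]; exact.
  by apply/mapP; exists ka; rewrite // mem_filter ek eqxx.
pose S' := [seq ka <- S | head 0%N (parts ka) != K.+1].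
have c0 ka : ka \in S' -> c ka = 0.
  apply: (IH d K); rewrite ?filter_uniq //; first by lia.
    move=> k; rewrite mem_filter => /andP[ne /bS/andP[-> b2]].
    by rewrite -ltnS ltn_neqAle ne b2.
  move=> al; rewrite -[RHS](eS al) /schur_comb big_filter big_mkcond.
  by apply: eq_big_seq => k kS; case: eqP => // /(top0 k kS) ->; rewrite mul0r.
move=> ka kaS; have [/(top0 ka kaS)//|/eqP ne] := head 0%N ka =P K.+1.
by apply: c0; rewrite mem_filter ne.
Qed.

(** The functions from exponents to coefficients that come from a symmetric
    function, except for the boundedness of the degree. *)
Definition sym_coef (f : seq nat -> int) : Prop :=
  (forall al be, perm_eq al be -> f al = f be) /\
  (forall al, f (0%N :: al) = f al).

Lemma sym_coef_zeros f al : sym_coef f -> all (leq^~ 0%N) al -> f al = f [::].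
Proof.
move=> [_ f0]; elim: al => //= a al IH /andP[]; rewrite leqn0 => /eqP ->.
by rewrite f0.
Qed.

Lemma sym_coef_schur_comb S c : sym_coef (schur_comb S c).
Proof.
split=> [al be p|al]; apply: eq_bigr => ka _;
  first by rewrite (kostka_perm _ p).
by rewrite kostka0.
Qed.

Lemma sym_coef_cons f a : sym_coef f -> sym_coef (fun al => f (a :: al)).
Proof.
case=> fp f0; split=> [al be p|al]; first by apply: fp; rewrite perm_cons.
by rewrite -[RHS]f0; apply: fp; apply/seq.permP => x /=; rewrite addnCA.
Qed.

(** Schur functions span. The coefficient of the highest possible power of
    one variable is a symmetric function of smaller degree; adding a row to
    the partitions in its expansion gives a combination of Schur functions
    with the same highest coefficient as f, and the difference has smaller
    degree in each variable by symmetry. *)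
Lemma schur_comb_ex d K f : sym_coef f ->
  (forall al, f al != 0 -> (sumn al <= d)%N && all (leq^~ K) al) ->
  exists S c, [/\ uniq S,
    forall ka : intpart, ka \in S -> (sumn ka <= d)%N && (head 0 ka <= K)%N &
    f =1 schur_comb S c].
Proof.
(* Both reductions decrease d + K: from K + 1 they lead to d - (K + 1) with the
   same K + 1, and to d with K. *)
have [s] := ubnP (d + K); elim: s d K f => // s IH d [|K] f lt sf bf.
  exists [:: row_part 0], (fun=> f [::]); split=> // [ka|al].
    by rewrite inE => /eqP ->.
  rewrite /schur_comb big_seq1; have [al0|al_pos] := boolP (all (leq^~ 0%N) al).
    have sk := sym_coef_schur_comb [:: row_part 0] (fun=> 1).
    have := sym_coef_zeros sk al0; rewrite /schur_comb !big_seq1 !mul1r => ->.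
    by rewrite mulr1; apply: sym_coef_zeros.
  have -> : f al = 0 by apply: contraNeq al_pos => /bf/andP[].
  have [->|/kostka_sumn e] := eqVneq (kostka (row_part 0) al) 0%N;
    first by rewrite mulr0.
  case/allP: al_pos => a; elim: al e => //= b al IHal.
  by move/eqP; rewrite addn_eq0 => /andP[/eqP -> /eqP/IHal h];
    rewrite inE => /orP[/eqP ->|/h].
have [le_d|lt_d] := leqP K.+1 d; last first.
  have [|//||S [c [uS bS eS]]] := IH d K f; first by lia.
    move=> al /bf/andP[sz _]; rewrite sz; apply/allP => a aal.
    rewrite -ltnS; apply: leq_trans lt_d; rewrite ltnS; apply: leq_trans sz.
    by rewrite sumnE (big_rem a) //= leq_addr.
  by exists S, c; split=> // ka /bS/andP[-> /leqW ->].
have [||S1 [c1 [uS1 bS1 eS1]]] :=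
  IH (d - K.+1)%N K.+1 _ _ (sym_coef_cons K.+1 sf).
- by lia.
- by move=> al /bf/= /andP[sz /andP[_ ->]]; rewrite leq_subRL // sz.
(* The combination over T has the same coefficient of x ^ (K + 1) as f. *)
pose T := [seq add_row K.+1 ka | ka <- S1].
pose cT := c1 \o unrow.
have headT ka : ka \in T -> head 0%N (parts ka) = K.+1.
  by move=> /mapP[k /bS1/andP[_ le] ->]; rewrite head_sqcup.
have eT al : schur_comb T cT (K.+1 :: al) = f (K.+1 :: al).
  rewrite eS1 /schur_comb big_map; apply: eq_big_seq => k /bS1/andP[_ le].
  by rewrite -[cT _]/(c1 (unrow (add_row K.+1 k))) unrow_sqcup //
    kostka_add_row.
pose f' al := f al - schur_comb T cT al.
have sf' : sym_coef f'.
  have [[fp f0] [ep e0]] := (sf, sym_coef_schur_comb T cT).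
  by split=> [al be p|al]; rewrite /f' ?(fp _ _ p) ?(ep _ _ p) // f0 e0.
have bT ka : ka \in T -> (sumn (parts ka) <= d)%N.
  move=> /mapP[k /bS1/andP[b1 b2] ->]; rewrite sumn_add_row //.
  by rewrite -leq_subRL.
have [|//||S2 [c2 [uS2 bS2 eS2]]] := IH d K f'; first by lia.
  move=> al f'al; apply/andP; split.
    have [fal|/bf/andP[] //] := eqVneq (f al) 0.
    apply: contraNleq f'al => lt_d; rewrite /f' fal sub0r oppr_eq0 /schur_comb.
    rewrite big1_seq // => ka /andP[_ kaT].
    have [->|/kostka_sumn e] := eqVneq (kostka ka al) 0%N;
      first by rewrite mulr0.
    by have := bT ka kaT; rewrite -e leqNgt lt_d.
  apply/allP => a aal; apply: contraNleq f'al => lt_a.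
  rewrite (sf'.1 _ _ (perm_to_rem aal)) /f'.
  have [->|ne] := eqVneq a K.+1; first by rewrite eT subrr.
  have {ne}lt_a : (K.+1 < a)%N by rewrite ltn_neqAle eq_sym ne.
  have -> : f (a :: rem a al) = 0.
    apply/eqP; apply: contraTT lt_a => /bf/andP[_ /= /andP[le _]].
    by rewrite -leqNgt.
  rewrite sub0r oppr_eq0 /schur_comb big1_seq // => ka /andP[_ kaT].
  by rewrite kostka_gt_head ?mulr0 // headT.
exists (T ++ S2),
  (fun ka => if head 0%N (parts ka) == K.+1 then cT ka else c2 ka).
have hS2 ka : ka \in S2 -> (head 0%N (parts ka) == K.+1) = false.
  by move=> /bS2/andP[_ le]; apply/negbTE; rewrite neq_ltn ltnS le.
split=> [|ka|al].
- rewrite cat_uniq uS2 andbT; apply/andP; split.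
    rewrite map_inj_in_uniq // => k k' /bS1/andP[_ h] /bS1/andP[_ h'] e.
    by rewrite -(unrow_sqcup h) -(unrow_sqcup h') e.
  by apply/hasPn => ka /hS2 /negbT; apply: contra => /headT ->.
- rewrite mem_cat => /orP[kaT|/bS2/andP[-> /leqW //]].
  by rewrite bT //= headT.
rewrite /schur_comb big_cat /=.
rewrite [X in X + _](_ : _ = schur_comb T cT al); last first.
  by apply: eq_big_seq => ka /headT ->; rewrite eqxx.
rewrite [X in _ + X](_ : _ = schur_comb S2 c2 al); last first.
  by apply: eq_big_seq => ka /hS2 ->.
by rewrite -eS2 addrC subrK.
Qed.

Lemma is_schur_expansionP (f : symfun) (a : seq nat -> int) S c :
  (forall al, (f (size al))@_(mnm_of_seq (size al) al) = a al) ->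
  a =1 schur_comb S c <->
  forall N, f N = \sum_(ka <- S) c ka *: schur ka N.
Proof.
move=> fa; split=> [aE N|fE al].
  apply/mpolyP => m; rewrite !(mcoeff_seq _ m) raddf_sum /=.
  have := fa m; rewrite size_tuple => ->; rewrite aE.
  by apply: eq_bigr => ka _; rewrite mcoeffZ schur_coef ?size_tuple.
rewrite -fa fE raddf_sum /=.
by apply: eq_bigr => ka _; rewrite mcoeffZ schur_coef.
Qed.

(** Since expansions in Schur functions are unique, any expansion of f is the
    one that is chosen in schur_coord. *)
Lemma schur_coordE (f : symfun) (a : seq nat -> int) (S : seq intpart) c la :
  (forall al, (f (size al))@_(mnm_of_seq (size al) al) = a al) ->
  uniq S -> a =1 schur_comb S c ->
  schur_coord f la = if la \in S then c la else 0.
Proof.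
move=> fa uS aE.
pose A := [fset ka in S]%fset.
pose c0 : {fsfun intpart -> int with 0} := [fsfun ka in A => c ka].
have c0E ka : c0 ka = if ka \in S then c ka else 0 by rewrite fsfunE inE.
have extend_sum (d : {fsfun intpart -> int with 0}) (U : seq intpart) al :
    uniq U -> {subset finsupp d <= U} ->
    schur_comb (finsupp d) d al = schur_comb U d al.
  move=> uU dU; rewrite /schur_comb [RHS](bigID (mem (finsupp d))) /= [X in _ +
    X]big1 ?addr0.
    rewrite -[RHS]big_filter; apply/perm_big/uniq_perm;
      rewrite ?fset_uniq ?filter_uniq //.
    by move=> k; rewrite mem_filter; case: (boolP (k \in finsupp d)) =>
      //= /dU ->.
  by move=> k kd; rewrite fsfun_dflt // mul0r.
have c0_exp : is_schur_expansion f c0.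
  apply/(is_schur_expansionP _ _ fa) => al; rewrite aE (extend_sum _ S) //.
    by apply: eq_big_seq => ka kaS; rewrite c0E kaS.
  by move=> ka; rewrite mem_finsupp c0E; case: ifP => //; rewrite eqxx.
rewrite -c0E; congr (fun_of_fsfun _ la); apply: classical_sets.xget_unique =>
  // d d_exp.
apply/fsfunP => ka.
pose U := undup (finsupp d ++ finsupp c0 ++ [:: ka]).
have uU : uniq U by apply: undup_uniq.
have kaU : ka \in U by rewrite mem_undup !mem_cat inE eqxx !orbT.
apply/eqP; rewrite -subr_eq0; apply/eqP.
apply: (@schur_comb_eq0 U (fun k => d k - c0 k) uU) kaU => al.
have dE : schur_comb U d al = a al.
  rewrite -extend_sum // => [|k kd]; last by rewrite mem_undup mem_cat kd.
  by have /(is_schur_expansionP _ _ fa) -> := d_exp.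
have c0aE : schur_comb U c0 al = a al.
  rewrite -extend_sum // => [|k kd]; last by rewrite mem_undup !mem_cat kd orbT.
  by have /(is_schur_expansionP _ _ fa) -> := c0_exp.
rewrite -[RHS](subrr (a al)) -{1}dE -c0aE /schur_comb -sumrB.
by apply: eq_bigr => k _; rewrite mulrBl.
Qed.

Lemma hall_schur f la : hall f (schur la) = schur_coord f la.
Proof.
have coord k : schur_coord (schur la) k = if k \in [:: la] then 1 else 0.
  apply: (@schur_coordE _ (fun al => (kostka la al)%:R) [:: la] (fun=> 1)) =>
    // al.
    exact: schur_coef.
  by rewrite /schur_comb big_seq1 mul1r.
rewrite /hall; under eq_bigr do rewrite coord inE.
have [las|las] := boolP (la \in finsupp (schur_coord f)).
  rewrite (bigD1_seq la) ?fset_uniq //= eqxx mulr1 big1 ?addr0 // =>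
    k /negPf ->.
  by rewrite mulr0.
rewrite fsfun_dflt // big1_seq // => k /andP[_ ks].
by case: eqP => [ek|_]; [rewrite -ek ks in las | rewrite mulr0].
Qed.

(** * Plethysm by a partition with a first row added *)

(** For r = 0 the row is not part of the partition, but a trailing zero does
    not change the tableaux. *)
Lemma plethysm_row_coef (mu nu : intpart) r al : (head 0 mu <= r)%N ->
  plethysm_coef nu (add_row r mu) al = plethysm_coef nu (r :: mu) al.
Proof.
move=> le; rewrite /plethysm_coef parts_sqcup //.
case: r le => [|r] //; rewrite leqn0 => /eqP/head0_nil -> /=.
congr (_ @_ _); congr schur_eval; exact: esym (tab_weights_rcons0 [::] _).
Qed.

Lemma row_sorted (mu : intpart) r : (head 0 mu <= r)%N -> sorted geq (r :: mu).
Proof. by have := intpart_sorted mu; case: (parts mu) => //= a l -> ->. Qed.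

(** The expansion of the plethysm by the enlarged partition determines that
    of the smaller plethysm, so that its existence has to be proved for the
    former only. *)
Lemma schur_coord_plethysm_add_row (nu mu la : intpart) r (n := sumn nu) :
  (head 0 mu <= r)%N ->
  schur_coord (plethysm (schur nu) (add_row r mu)) (add_row (n * r) la) =
  schur_coord (plethysm (schur nu) mu) la.
Proof.
move=> le; pose b al := plethysm_coef nu (r :: mu) al.
have smu := row_sorted le.
have bE al : plethysm_coef nu (add_row r mu) al = b al by apply:
  plethysm_row_coef.
have sb : sym_coef b.
  split=> [al be|al]; first exact: plethysm_coef_perm.
  exact: plethysm_coef0.
have [al|S [c [uS bS eS]]] := @schur_comb_ex (n * sumn (r :: mu)) (n * r) b sb.
  move=> b0; rewrite (plethysm_coef_homog b0) leqnn /=; apply/allP => a aal.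
  apply: contraNleq b0 => lt; rewrite (sb.1 _ _ (perm_to_rem aal)).
  by apply/eqP; apply: plethysm_coef_gt.
rewrite (schur_coordE _ (a := b) _ uS eS); last first.
  by move=> al; rewrite plethysm_coefE.
pose S' := [seq unrow ka | ka <- S & head 0%N (parts ka) == (n * r)%N].
rewrite (@schur_coordE _ (plethysm_coef nu mu) S' (c \o add_row (n * r)) la);
  last first.
- move=> al; rewrite -schur_comb_top => [|ka /bS/andP[] //].
  by rewrite -eS /b plethysm_coef_top.
- exact: uniq_unrow.
- by move=> al; rewrite plethysm_coefE.
rewrite /=; congr (if _ then _ else _); apply/idP/mapP => [laS|[ka + ->]].
  have /andP[_ h] := bS _ laS.
  (* Nothing is lost for la_1 > n r: the partition with the row n r added
     then has first part la_1, so it does not lie in S. *)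
  have hla := leq_trans (head_le_sqcup (n * r) la) h.
  by exists (add_row (n * r) la); rewrite ?mem_filter ?head_sqcup ?eqxx //
    unrow_sqcup.
by rewrite mem_filter => /andP[/eqP <-]; rewrite sqcup_unrow.
Qed.

Local Close Scope ring_scope.

Theorem theorem1p1 (m n : nat) (mu nu la : intpart)
    (hmu : sumn mu = m) (hnu : sumn nu = n) (hla : sumn la = m * n)
    (r : nat) (hr : \max_(a <- mu) a <= r) :
  hall (plethysm (schur nu) (sqcup (row_part r) mu))
       (schur (sqcup (row_part (n * r)) la)) =
  hall (plethysm (schur nu) mu) (schur la).
Proof.
rewrite !hall_schur -hnu; apply: schur_coord_plethysm_add_row.
apply: leq_trans hr; case: (parts mu) => //= a l.
by rewrite big_cons leq_maxl.
Qed.
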